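(* Let $C\subset\mathbb{P}^n$ be an irreducible hypersurface not contained in $\Delta_{n-1}$, and let $t\ge 2$ be an integer. If $C^{\star t}=C$, then $C$ is a binomial hypersurface of type $(t,\epsilon)$ for some integer $\epsilon$ with $1\le\epsilon\le t-1$. In particular, if $\gcd(t-1,\epsilon)=1$, then $t$ is the smallest integer $\geq 2$ for which $C^{\star t}=C$ holds.
   Context: We work over $\mathbb{C}$. For points $p=[a_0:\cdots:a_n]$ and $q=[b_0:\cdots:b_n]$ of $\mathbb{P}^n$ with $a_ib_i\neq 0$ for some $i$, put $p\star q=[a_0b_0:\cdots:a_nb_n]$; if $a_ib_i=0$ for all $i$, then $p\star q$ is not defined. For varieties $V,W\subset\mathbb{P}^n$, the Hadamard product $V\star W$ is the Zariski closure of $\{p\star q: p\in V,\ q\in W,\ p\star q \text{ is defined}\}$. The Hadamard powers are $V^{\star 0}=\{[1:\cdots:1]\}$ and $V^{\star r}=V\star V^{\star(r-1)}$ for $r\ge 1$. $\Delta_{n-1}\subset\mathbb{P}^n$ is the union of the coordinate hyperplanes $x_i=0$, $i=0,\dots,n$. For $I=(i_0,\dots,i_n)\in\mathbb{N}^{n+1}$, $X^I$ denotes the monomial $x_0^{i_0}\cdots x_n^{i_n}$. A binomial hypersurface is an irreducible hypersurface in $\mathbb{P}^n$ whose defining equation (generator of its homogeneous ideal) is of the form $\alpha_1X^{I_1}-\alpha_2X^{I_2}=0$, with $X^{I_1}\neq X^{I_2}$ of the same degree and $\alpha_1,\alpha_2\in\mathbb{C}$ nonzero. It is of type $(t,\epsilon)$,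 for integers $t\ge 2$ and $1\le\epsilon\le t-1$, if it has such an equation with $\alpha_1=1$ and $\alpha_2=\xi^{\epsilon}$, where $\xi$ is a primitive $(t-1)$-th root of unity. *)

(* Defs.v *)
From HB Require Import structures.
From mathcomp Require Import all_boot all_order all_algebra generic_quotient.
From mathcomp Require Import mpoly complex.
From mathcomp Require Import boolp classical_sets reals.

Set Implicit Arguments.
Unset Strict Implicit.
Unset Printing Implicit Defensive.

Import GRing.Theory.
Local Open Scope ring_scope.
Local Open Scope quotient_scope.
Local Open Scope classical_set_scope.

Section ProjectiveSpace.
Variables (K : fieldType) (n : nat).

Definition nzvec := {a : 'rV[K]_n.+1 | a != 0}.

Definition collinear (a b : nzvec) : bool :=
  `[< exists2 c : K, c != 0 & val a = c *: val b >].

Lemma collinear_refl : reflexive collinear.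
Proof. by move=> a; apply/asboolP; exists 1; rewrite ?oner_neq0 ?scale1r. Qed.

Lemma collinear_sym : ssrbool.symmetric collinear.
Proof.
suff H a b : collinear a b -> collinear b a.
  by move=> a b; apply/idP/idP; apply: H.
move=> /asboolP[c c0 ab]; apply/asboolP; exists c^-1; first by rewrite invr_eq0.
by rewrite ab scalerA mulVf // scale1r.
Qed.

Lemma collinear_trans : transitive collinear.
Proof.
move=> b a d /asboolP[x x0 ab] /asboolP[y y0 bd]; apply/asboolP.
by exists (x * y); rewrite ?mulf_neq0 // ab bd scalerA.
Qed.

Canonical collinear_equiv :=
  EquivRel collinear collinear_refl collinear_sym collinear_trans.

Definition Pn := {eq_quot collinear_equiv}.

Definition pt (a : nzvec) : Pn := \pi_Pn a.

Lemma ptP (a b : nzvec) :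
  pt a = pt b <-> exists2 c : K, c != 0 & val a = c *: val b.
Proof. by split=> [/eqquotP/asboolP|H]; [|apply/eqquotP/asboolP]. Qed.

(* For f homogeneous this does not depend on the choice of a.  For an arbitrary
   f, over an infinite field, vanishing at all representatives of p amounts to
   the vanishing at p of all the homogeneous components of f. *)
Definition vanishes_at (f : {mpoly K[n.+1]}) (p : Pn) : Prop :=
  forall a : nzvec, p = pt a -> f.@[val a 0] = 0.

Definition zero_locus (S : set {mpoly K[n.+1]}) : set Pn :=
  [set p | forall f, S f -> vanishes_at f p].

Definition zariski_closed (V : set Pn) : Prop :=
  exists2 S : set {mpoly K[n.+1]},
    (forall f, S f -> exists d, f \is d.-homog) & V = zero_locus S.

Definition zariski_closure (A : set Pn) : set Pn := smallest zariski_closed A.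

Definition irreducible_closed (V : set Pn) : Prop :=
  [/\ zariski_closed V, V !=set0 &
      forall A B : set Pn, zariski_closed A -> zariski_closed B ->
        V `<=` A `|` B -> V `<=` A \/ V `<=` B].

(* With vanishes_at as above, this is the homogeneous ideal of V when K is
   infinite. *)
Definition ideal_of (V : set Pn) : set {mpoly K[n.+1]} :=
  [set f | forall p, V p -> vanishes_at f p].

Definition defining_equation (V : set Pn) (f : {mpoly K[n.+1]}) : Prop :=
  forall g : {mpoly K[n.+1]}, ideal_of V g <-> exists h, g = h * f.

Definition hypersurface (V : set Pn) : Prop :=
  exists (d : nat) (f : {mpoly K[n.+1]}),
    [/\ (0 < d)%N, f != 0, f \is d.-homog & V = zero_locus [set f]].

Definition irreducible_hypersurface (V : set Pn) : Prop :=
  hypersurface V /\ irreducible_closed V.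

Definition coord_hyperplanes : set Pn :=
  \bigcup_(i in [set: 'I_n.+1]) zero_locus [set 'X_i].

Definition hmul (a b : 'rV[K]_n.+1) : 'rV[K]_n.+1 :=
  \row_i (a 0 i * b 0 i).

(* star p q r : the product of p and q is defined and equal to r; the nonzero
   vector c witnesses definedness. *)
Definition star (p q r : Pn) : Prop :=
  exists a b c : nzvec,
    [/\ p = pt a, q = pt b, r = pt c & val c = hmul (val a) (val b)].

Definition hadamard (V W : set Pn) : set Pn :=
  zariski_closure [set r | exists p q, [/\ V p, W q & star p q r]].

Lemma ones_neq0 : const_mx 1 != 0 :> 'rV[K]_n.+1.
Proof.
by apply/eqP => /rowP /(_ ord0); rewrite !mxE; apply/eqP/oner_neq0.
Qed.

Definition ones_pt : Pn := pt (exist _ (const_mx 1) ones_neq0).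

Fixpoint hadamard_pow (V : set Pn) (r : nat) : set Pn :=
  if r is r'.+1 then hadamard V (hadamard_pow V r') else [set ones_pt].

Definition binomial_equation (V : set Pn) (a1 a2 : K) : Prop :=
  exists I1 I2 : 'X_{1..n.+1},
    [/\ I1 != I2, mdeg I1 = mdeg I2 &
        defining_equation V (a1 *: 'X_[I1] - a2 *: 'X_[I2])].

Definition binomial_hypersurface (V : set Pn) : Prop :=
  irreducible_hypersurface V /\
  exists a1 a2 : K, [/\ a1 != 0, a2 != 0 & binomial_equation V a1 a2].

Definition binomial_hypersurface_of_type (V : set Pn) (t e : nat) : Prop :=
  [/\ (2 <= t)%N, (1 <= e <= t - 1)%N, binomial_hypersurface V &
      exists2 xi : K, (t - 1).-primitive_root xi &
        binomial_equation V 1 (xi ^+ e)].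

End ProjectiveSpace.

Arguments coord_hyperplanes K n : clear implicits.

(* Main.v *)
Require Import Defs.
From mathcomp Require Import all_boot all_order all_algebra.
From mathcomp Require Import cyclic separable cyclotomic.
From mathcomp Require Import mpoly complex.
From mathcomp Require Import boolp classical_sets reals.
From mathcomp Require Import zify.

(* Let Z be the set of torus points of the affine cone of C = V(f). Since
   C^{*t} = C, products of t points of Z are in Z, so products of t - 1 points
   of Z multiply Z into itself. Dedekind's independence of characters, applied to
   this set of multipliers, shows that a nonzero polynomial vanishing on Z has two
   monomials X^a, X^b such that the character X^(a - b) is constant on Z. As C is
   a hypersurface, the exponents of the characters constant on Z form a group of
   rank one; let m generate it, let c be the value of X^m on Z, and let B be the
   binomial X^(m+) - c X^(m-). A polynomial vanishing on Z has a remainder modulo B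
   with no monomial divisible by X^(m+), hence with no two monomials differing by a
   multiple of m: the remainder is 0, and B generates the ideal of C. Finally
   c^t = c by evaluating X^m at v^t for v in Z. *)

Import Order.TTheory GRing.Theory Num.Theory.

Set Implicit Arguments.
Unset Strict Implicit.
Unset Printing Implicit Defensive.

Local Open Scope ring_scope.
Local Open Scope complex_scope.
Local Open Scope classical_set_scope.

(** * Roots in algebraically closed fields *)

(** In characteristic zero X^n - 1 is separable, so it has n distinct roots, one of which has order
    n. *)
Lemma closed_prim_root_exists (K : numClosedFieldType) (n : nat) :
  (0 < n)%N -> exists z : K, n.-primitive_root z.
Proof.
pose p : {poly K} := 'X^n - 1; have [r Dp] := closed_field_poly_normal p.
move=> n_gt0; rewrite (monicP _) ?monicXnsubC // scale1r in Dp.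
have rn1 : all n.-unity_root r by apply/allP=> z; rewrite -root_prod_XsubC -Dp.
have sz_r : (n < (size r).+1)%N.
  by rewrite -(size_prod_XsubC r id) -Dp size_XnsubC.
have [|z] := hasP (has_prim_root n_gt0 rn1 _ sz_r); last by exists z.
by rewrite -separable_prod_XsubC -Dp separable_Xn_sub_1 // pnatr_eq0 -lt0n.
Qed.

(** Dividing out the largest power of X leaves a factor that is nonzero at 0; were it constant, [p]
    would have a single nonzero coefficient. *)
Lemma closed_root_neq0 (K : closedFieldType) (p : {poly K}) (j k : nat) :
  j != k -> p`_j != 0 -> p`_k != 0 -> exists2 s : K, s != 0 & p.[s] = 0.
Proof.
move=> jk pj pk.
have p0 : p != 0 by apply: contraNneq pj => ->; rewrite coef0.
have [m [q]] := multiplicity_XsubC p 0; rewrite p0 subr0 /= => q0 Dp.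
have [/size_poly1P[c c0 Dq]|/closed_rootP[s qs]] := boolP (size q == 1%N).
  move: pj pk jk; rewrite Dp Dq !coefCM !coefXn.
  by case: (eqVneq j m) => [->|_]; case: (eqVneq k m); rewrite ?mulr0 ?eqxx.
exists s; first by apply: contraNneq q0 => <-.
by rewrite Dp hornerM (rootP qs) mul0r.
Qed.

(** * Characters of the torus and their independence *)

Section Torus.
Variables (K : fieldType) (N : nat).
Implicit Types (v w q : 'I_N -> K) (d : 'rV[int]_N) (m a b : 'X_{1..N}).
Implicit Types (g : {mpoly K[N]}).

Definition torus v := forall i, v i != 0.

Definition pmul v w := fun i => v i * w i.

Definition scale_coord i (s : K) v := fun j => if j == i then s * v j else v j.

Definition chi d v := \prod_i v i ^ d 0 i.

Definition expo m : 'rV[int]_N := \row_i (m i)%:Z.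

(** The part d+ of d = d+ - d-, as a monomial exponent; d- is [pos_part (- d)]. *)
Definition pos_part d := 
  [multinom (if (0 <= d 0 i)%R then `|d 0%R i|%N else 0%N) | i < N].

(** The polynomial g(q x), written termwise so that its coefficients can be compared with those of
    [g]. *)
Definition dilate q g : {mpoly K[N]} :=
  \sum_(m <- msupp g) (g@_m * 'X_[m].@[q]) *: 'X_[m].

Lemma torus_pmul v w : torus v -> torus w -> torus (pmul v w).
Proof. by move=> Tv Tw i; rewrite mulf_neq0. Qed.

Lemma torus_scale_coord i s v : s != 0 -> torus v -> torus (scale_coord i s v).
Proof. by move=> s0 Tv j; rewrite /scale_coord; case: ifP; rewrite ?mulf_neq0. Qed.

Lemma meval_monom_neq0 m v : torus v -> 'X_[m].@[v] != 0.
Proof.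
move=> Tv; rewrite mevalX prodf_seq_neq0.
by apply/allP=> i _; rewrite /= expf_neq0.
Qed.

Lemma meval_monom_pmul m v w : 'X_[m].@[pmul v w] = 'X_[m].@[v] * 'X_[m].@[w].
Proof. by rewrite !mevalX -big_split; apply: eq_bigr => i _; rewrite exprMn. Qed.

Lemma meval_monom_scale_coord m i s v :
  'X_[m].@[scale_coord i s v] = s ^+ m i * 'X_[m].@[v].
Proof.
rewrite !mevalX (bigD1 i) //= [in RHS](bigD1 i) //= /scale_coord eqxx exprMn mulrA.
by congr (_ * _); apply: eq_bigr => j /negPf->.
Qed.

Lemma mevalEX g v : g.@[v] = \sum_(m <- msupp g) g@_m * 'X_[m].@[v].
Proof. by rewrite mevalE; apply: eq_bigr => m _; rewrite mevalX. Qed.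

Lemma mcoeff_sum_msupp g (c : 'X_{1..N} -> K) m :
  (\sum_(m <- msupp g) (g@_m * c m) *: 'X_[m])@_m = g@_m * c m.
Proof.
rewrite raddf_sum /=.
have [mg|mg] := boolP (m \in msupp g).
  rewrite (bigD1_seq m) ?msupp_uniq //= mcoeffZ mcoeffX eqxx mulr1 big1 ?addr0 //.
  by move=> k /negPf km; rewrite mcoeffZ mcoeffX km mulr0.
rewrite (memN_msupp_eq0 mg) mul0r big1_seq // => k /andP[_ kg].
rewrite mcoeffZ mcoeffX; case: eqVneq => [km|]; last by rewrite mulr0.
by rewrite -km kg in mg.
Qed.

Lemma meval_sum_msupp g (c : 'X_{1..N} -> K) v :
  (\sum_(m <- msupp g) (g@_m * c m) *: 'X_[m]).@[v]
    = \sum_(m <- msupp g) g@_m * c m * 'X_[m].@[v].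
Proof. by rewrite raddf_sum /=; apply: eq_bigr => m _; rewrite mevalZ. Qed.

Lemma mcoeff_dilate q g m : (dilate q g)@_m = g@_m * 'X_[m].@[q].
Proof. exact: mcoeff_sum_msupp. Qed.

Lemma meval_dilate q g v : (dilate q g).@[v] = g.@[pmul q v].
Proof.
rewrite meval_sum_msupp mevalEX; apply: eq_bigr => m _.
by rewrite meval_monom_pmul mulrA.
Qed.

(* Dedekind's independence of characters: if X^a and X^b differ at some q in H,
   then g(q x) - X^b(q) g(x) still vanishes on S and has fewer terms. *)
Lemma dedekind_pair (S H : set ('I_N -> K)) g :
  (exists2 v, S v & torus v) ->
  (forall q v, H q -> S v -> S (pmul q v)) ->
  (forall v, S v -> g.@[v] = 0) -> g != 0 ->
  exists a b, [/\ a \in msupp g, b \in msupp g, a != b &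
    forall q, H q -> 'X_[a].@[q] = 'X_[b].@[q]].
Proof.
move=> [v0 Sv0 Tv0] SH; have [k] := ubnP (size (msupp g)).
elim: k g => // k IH g szg Sg g0.
case E : (msupp g) (msupp_uniq g) => [|a [|b l]] Ug.
- by move/eqP: E; rewrite msupp_eq0 (negPf g0).
(* A single nonzero term cannot vanish at the torus point [v0]. *)
- have := Sg _ Sv0; rewrite mevalEX E big_seq1 => /eqP.
  rewrite mulf_eq0 (negPf (meval_monom_neq0 _ Tv0)) orbF.
  have : a \in msupp g by rewrite E inE eqxx.
  by rewrite mcoeff_msupp => /negPf->.
have ag : a \in msupp g by rewrite E !inE eqxx.
have bg : b \in msupp g by rewrite E !inE eqxx orbT.
have ab : a != b by move: Ug; rewrite /= !inE negb_or -andbA => /and3P[].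
have [Hab|] := pselect (forall q, H q -> 'X_[a].@[q] = 'X_[b].@[q]).
  by exists a, b; rewrite -E.
move=> /existsNP[q /not_implyP[Hq /eqP qab]].
pose g' := dilate q g - 'X_[b].@[q] *: g.
have cg' m : g'@_m = g@_m * ('X_[m].@[q] - 'X_[b].@[q]).
  by rewrite mcoeffB mcoeff_dilate mcoeffZ mulrBr [_ * g@__]mulrC.
have sg' : {subset msupp g' <= rem b (msupp g)}.
  move=> m; rewrite mcoeff_msupp cg' mulf_eq0 negb_or subr_eq0 -mcoeff_msupp.
  case/andP=> mg mb; rewrite mem_rem_uniq ?msupp_uniq // inE mg andbT.
  by apply: contraNneq mb => ->.
have g'0 : g' != 0.
  apply/eqP => /(congr1 (mcoeff a)); rewrite cg' mcoeff0 => /eqP.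
  rewrite mulf_eq0 subr_eq0 (negPf qab) orbF.
  by move: ag; rewrite mcoeff_msupp => /negPf->.
have szg' : (size (msupp g') < k)%N.
  have := uniq_leq_size (msupp_uniq g') sg'.
  rewrite size_rem // => h; apply: (leq_ltn_trans h).
  by move: szg; rewrite ltnS; case: (size _) (size_rem bg) => //; rewrite E.
have Sg' v : S v -> g'.@[v] = 0.
  by move=> Sv; rewrite mevalB meval_dilate mevalZ !Sg ?mulr0 ?subrr //; apply: SH.
have [a' [b' [a'g b'g ab' Hab']]] := IH _ szg' Sg' g'0.
by exists a', b'; rewrite -E; split=> //; apply: (mem_rem (x := b)); apply: sg'.
Qed.

Lemma chi_neq0 d v : torus v -> chi d v != 0.
Proof.
by move=> Tv; rewrite prodf_seq_neq0; apply/allP=> i _; rewrite /= expfz_neq0.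
Qed.

Lemma chiD d1 d2 v : torus v -> chi (d1 + d2) v = chi d1 v * chi d2 v.
Proof.
by move=> Tv; rewrite -big_split; apply: eq_bigr => i _; rewrite mxE expfzDr.
Qed.

Lemma chiZ (k : int) d v : chi (k *: d) v = chi d v ^ k.
Proof.
rewrite /chi; elim/big_ind2: _ => [|x1 x2 y1 y2 -> ->|i _]; first by rewrite exp1rz.
- by rewrite expfzMl.
- by rewrite mxE exprz_exp mulrC.
Qed.

Lemma chiN d v : chi (- d) v = (chi d v)^-1.
Proof. by rewrite -scaleN1r chiZ. Qed.

Lemma chiM d v w : chi d (pmul v w) = chi d v * chi d w.
Proof. by rewrite -big_split; apply: eq_bigr => i _; rewrite expfzMl. Qed.

Lemma chi_scale_coord d i s v : chi d (scale_coord i s v) = s ^ d 0 i * chi d v.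
Proof.
rewrite /chi (bigD1 i) //= [in RHS](bigD1 i) //= /scale_coord eqxx expfzMl mulrA.
by congr (_ * _); apply: eq_bigr => j /negPf->.
Qed.

Lemma chi_cst d (s : K) : s != 0 -> chi d (fun=> s) = s ^ (\sum_i d 0 i).
Proof.
move=> s0; rewrite /chi; elim/big_ind2: _ => //= [x1 x2 y1 y2 -> ->].
by rewrite expfzDr.
Qed.

Lemma chi_expo m v : chi (expo m) v = 'X_[m].@[v].
Proof. by rewrite mevalX; apply: eq_bigr => i _; rewrite mxE. Qed.

Lemma expo_pos_part d : expo (pos_part d) - expo (pos_part (- d)) = d.
Proof.
apply/rowP=> i; rewrite !mxE !mnmE !mxE.
by move: (d 0 i) => z; case: (leP 0 z); case: (leP 0 (- z)); lia.
Qed.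

Lemma chi_pos_part d v : torus v ->
  'X_[pos_part d].@[v] = chi d v * 'X_[pos_part (- d)].@[v].
Proof. by move=> Tv; rewrite -!chi_expo -chiD // -{2}[d]expo_pos_part subrK. Qed.

Lemma pos_part_inj d : pos_part d = pos_part (- d) -> d = 0.
Proof. by move=> E; rewrite -[d]expo_pos_part E subrr. Qed.

End Torus.

(** * Characters constant on the torus points of a hypersurface *)

Section TorusHypersurface.
Variables (K : numClosedFieldType) (N : nat).
Implicit Types (v w q : 'I_N -> K) (d : 'rV[int]_N) (a b m : 'X_{1..N}).
Implicit Types (S H : set ('I_N -> K)) (f g h : {mpoly K[N]}).

Definition chi_constant S d := forall v w, S v -> S w -> chi d v = chi d w.

Definition torus_zeros f : set ('I_N -> K) := [set v | torus v /\ f.@[v] = 0].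

Lemma expr2_inj (j k : nat) : 2 ^+ j = 2 ^+ k :> K -> j = k.
Proof. by move=> /eqP; rewrite -!natrX eqr_nat eqn_exp2l // => /eqP. Qed.

(** Otherwise independence of characters on the whole torus gives two distinct monomials that agree
    there; putting 2 in one coordinate and 1 elsewhere separates them. *)
Lemma torus_nonzero_value g : g != 0 -> exists2 v, torus v & g.@[v] != 0.
Proof.
move=> g0; apply/not_exists2P => gT.
have T1 : @torus K N (fun=> 1) by move=> i; apply: oner_neq0.
have gT0 v : torus v -> g.@[v] = 0.
  by move=> Tv; have [//|/negP] := gT v; rewrite negbK => /eqP.
have [a [b [_ _ /eqP ab Hab]]] :=
  dedekind_pair (ex_intro2 _ _ _ T1 T1) (@torus_pmul K N) gT0 g0.
apply: ab; apply/mnmP => i; apply: expr2_inj.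
have T2 : torus (scale_coord i 2 (fun=> 1 : K)).
  by apply: torus_scale_coord => //; rewrite pnatr_eq0.
have := Hab _ T2; rewrite !meval_monom_scale_coord => /eqP.
have X1 m : 'X_[m].@[fun=> 1 : K] = 1.
  by rewrite mevalX big1 // => j _; rewrite expr1n.
by rewrite !X1 !mulr1 => /eqP.
Qed.

Lemma chi_constantB S d d' : S `<=` @torus K N ->
  chi_constant S d -> chi_constant S d' -> chi_constant S (d - d').
Proof.
move=> ST cd cd' v w Sv Sw.
by rewrite !chiD ?chiN //; first rewrite (cd v w) // (cd' v w) //; apply: ST.
Qed.

Lemma chi_constantZ S (k : int) d : chi_constant S d -> chi_constant S (k *: d).
Proof. by move=> cd v w Sv Sw; rewrite !chiZ (cd v w). Qed.

(** Doubling coordinate i multiplies the character by 2^(d_i), and 2 is not a root of unity. *)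
Lemma chi_constant_scale_invariant S d i : (exists v, S v /\ torus v) ->
  (forall v, S v -> S (scale_coord i 2 v)) -> chi_constant S d -> d 0 i = 0.
Proof.
move=> [v [Sv Tv]] S2 cd.
have /esym/eqP := cd v _ Sv (S2 _ Sv).
rewrite chi_scale_coord -{2}[chi d v]mul1r.
rewrite (inj_eq (mulIf (chi_neq0 d Tv))) pexprz_eq1 ?ler0n //.
by rewrite (eqr_nat K 2 1) orbF => /eqP.
Qed.

(** All monomials of [f] have the same degree in x_i, so the scaling multiplies the value of [f] by
    a power of [s]. *)
Lemma torus_zeros_scale f i s v : s != 0 -> {in msupp f &, forall a b, a i = b i} ->
  torus_zeros f v -> torus_zeros f (scale_coord i s v).
Proof.
move=> s0 Ef [Tv fv]; split; first exact: torus_scale_coord.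
case E : (msupp f) => [|a l]; first by rewrite mevalEX E big_nil.
have af : a \in msupp f by rewrite E inE eqxx.
rewrite mevalEX -[RHS](mulr0 (s ^+ a i)) -[X in _ * X]fv [in RHS]mevalEX mulr_sumr.
apply: eq_big_seq => m mf.
by rewrite meval_monom_scale_coord (Ef m a) // mulrCA.
Qed.

(* If X_i occurs in f with two different exponents, the torus zeros of f project
   onto a dense subset of the remaining coordinates. *)
Lemma chi_constant_coord0_eq0 f d i a b : torus_zeros f !=set0 ->
  a \in msupp f -> b \in msupp f -> a i != b i ->
  chi_constant (torus_zeros f) d -> d 0 i = 0 -> d = 0.
Proof.
move=> [v0 Zv0] af bf ab cd di0; apply: contrapT => d0.
pose c := chi d v0.
pose h : {mpoly K[N]} := 'X_[pos_part d] - c *: 'X_[pos_part (- d)].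
have h0 : h != 0.
  apply/eqP => /(congr1 (mcoeff (pos_part d))).
  rewrite mcoeffB mcoeffZ !mcoeffX eqxx mcoeff0.
  case: eqVneq => [E|_]; first by case: d0; apply: pos_part_inj.
  by rewrite mulr0 subr0 => /eqP; rewrite oner_eq0.
(* [P k] collects the terms of [f] of degree k in x_i. *)
pose P k : {mpoly K[N]} := \sum_(m <- msupp f) (f@_m * (m i == k)%:R) *: 'X_[m].
have P0 m : m \in msupp f -> P (m i) != 0.
  rewrite mcoeff_msupp => fm; apply/eqP => /(congr1 (mcoeff m)).
  by rewrite mcoeff_sum_msupp mcoeff0 eqxx mulr1; apply/eqP.
have [|v Tv] := @torus_nonzero_value (P (a i) * P (b i) * h).
  by rewrite !mulf_neq0 ?P0.
rewrite !mevalM !mulf_eq0 !negb_or -andbA => /and3P[Pa Pb hv].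
(* p(s) is the value of [f] at [v] with coordinate i multiplied by s. By the choice of [v] it has
   two nonzero coefficients, hence a nonzero root. *)
pose p : {poly K} := \sum_(m <- msupp f) (f@_m * 'X_[m].@[v]) *: 'X^(m i).
have pk k : p`_k = (P k).@[v].
  rewrite meval_sum_msupp coef_sum; apply: eq_bigr => m _.
  by rewrite coefZ coefXn eq_sym mulrAC.
have ps s : p.[s] = f.@[scale_coord i s v].
  rewrite mevalEX horner_sum; apply: eq_bigr => m _.
  by rewrite hornerZ hornerXn meval_monom_scale_coord -mulrA [_ * s ^+ _]mulrC.
have [||s s0 fs] := closed_root_neq0 (p := p) ab; rewrite ?pk //.
have Zw : torus_zeros f (scale_coord i s v).
  by split; [apply: torus_scale_coord | rewrite -ps].
move/eqP: hv; apply; rewrite mevalB mevalZ chi_pos_part //.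
(* Since d_i = 0, changing coordinate i does not affect [chi d], so its value at [v] is the one at a
   torus zero of [f]. *)
suff -> : chi d v = c by rewrite subrr.
by rewrite /c (cd _ _ Zv0 Zw) chi_scale_coord di0 expr0z mul1r.
Qed.

(** The difference of the two sides has i-th coordinate 0, so it vanishes if x_i occurs in [f] with
    two exponents. If not, the torus zeros are stable under scaling of coordinate i, and d_i = d'_i
    = 0. *)
Lemma chi_constant_rank1 f d d' i : torus_zeros f !=set0 ->
  chi_constant (torus_zeros f) d -> chi_constant (torus_zeros f) d' ->
  d' 0 i *: d = d 0 i *: d'.
Proof.
move=> Z0 cd cm.
have ZT : torus_zeros f `<=` @torus K N by move=> v [].
have [Ef|/existsNP[a]] :=
    pselect (forall a, a \in msupp f -> forall b, b \in msupp f -> a i = b i).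
  have Zi x : chi_constant (torus_zeros f) x -> x 0 i = 0.
    apply: chi_constant_scale_invariant.
      by case: Z0 => v Zv; exists v; split=> //; case: Zv.
    move=> v; apply: torus_zeros_scale => [|a b af]; last exact: Ef.
    by rewrite pnatr_eq0.
  by rewrite !Zi // !scale0r.
move=> /not_implyP[af /existsNP[b /not_implyP[bf /eqP ab]]].
apply/eqP; rewrite -subr_eq0; apply/eqP.
apply: (chi_constant_coord0_eq0 Z0 af bf ab).
  by apply: chi_constantB => //; apply: chi_constantZ.
by rewrite !mxE mulrC subrr.
Qed.

(** As for subgroups of the integers: [m] has the least nonzero absolute value in a coordinate i
    where [d0] is nonzero. The remainder of a Euclidean division by m_i has i-th coordinate 0, and
    rank one makes it vanish. *)
Lemma chi_constant_cyclic f d0 : torus_zeros f !=set0 ->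
  chi_constant (torus_zeros f) d0 -> d0 != 0 ->
  exists m : 'rV[int]_N, [/\ m != 0, chi_constant (torus_zeros f) m &
    forall d, chi_constant (torus_zeros f) d -> exists k : int, d = k *: m].
Proof.
move=> Z0 cd0 d0N0.
have ZT : torus_zeros f `<=` @torus K N by move=> v [].
have [i d0i] : exists i, d0 0 i != 0.
  apply: contrapT => /forallNP H; move/eqP: d0N0; apply; apply/rowP => i.
  by rewrite mxE; have /negP := H i; rewrite negbK => /eqP.
pose Q n := `[< exists d, [/\ chi_constant (torus_zeros f) d, d 0 i != 0
                          & `|d 0%R i|%N = n] >].
have exQ : exists n, Q n by exists `|d0 0%R i|%N; apply/asboolP; exists d0.
case: (ex_minnP exQ) => n /asboolP[m [cm mi mn]] minn.
exists m; split=> //; first by apply: contraNneq mi => ->; rewrite mxE.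
move=> d cd; exists (divz (d 0 i) (m 0 i)); apply/eqP; rewrite -subr_eq0.
set r := d - _.
have cr : chi_constant (torus_zeros f) r.
  by apply: chi_constantB => //; apply: chi_constantZ.
have ri : r 0 i = modz (d 0 i) (m 0 i) by rewrite !mxE.
have ri0 : r 0 i = 0.
  apply: contrapT => /eqP rN0.
  have := minn `|r 0%R i|%N; rewrite leqNgt.
  have -> : (`|r 0%R i| < n)%N 
    by rewrite -mn ri; have := ltz_mod (d 0 i) mi; have := modz_ge0 (d 0 i) mi; lia.
  by move=> H; have : false by apply: H; apply/asboolP; exists r.
have := chi_constant_rank1 i Z0 cr cm; rewrite ri0 scale0r => /eqP.
by rewrite scalemx_eq0 (negPf mi).
Qed.

(** * Division by a binomial *)

(** Replacing X^a by c X^b lowers the exponent of x_i, so the rewriting terminates. *)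
Lemma binomial_division a b (c : K) i g : (b i < a i)%N ->
  exists h r, g = h * ('X_[a] - c *: 'X_[b]) + r /\
    forall m, (a <= m)%MM -> r@_m = 0.
Proof.
move=> ba; set B := 'X_[a] - _.
have divM m : exists h r, 'X_[m] = h * B + r /\ forall m', (a <= m')%MM -> r@_m' = 0.
  have [k] := ubnP (m i); elim: k m => // k IH m mk.
  have [am|am] := boolP (a <= m)%MM; last first.
    exists 0, 'X_[m]; rewrite mul0r add0r; split=> // m' am'.
    by rewrite mcoeffX; case: eqVneq am => // ->; rewrite am'.
  have [|h [r [E R]]] := IH (m - a + b)%MM.
    rewrite mnmDE mnmBE; move/mnm_lepP/(_ i): am.
    by move: (m i) (a i) (b i) mk ba; lia.
  exists ('X_[m - a] + c *: h), (c *: r); split; last first.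
    by move=> m' /R E'; rewrite mcoeffZ E' mulr0.
  rewrite -[in LHS](submK am) [LHS]mpolyXD mulrDl -addrA -scalerAl -scalerDr -E.
  by rewrite /B mulrBr -scalerAr -!mpolyXD subrK.
elim/mpolyind: g => [|x m g _ _ [h [r [E R]]]].
  by exists 0, 0; rewrite mul0r addr0; split=> // m _; rewrite mcoeff0.
have [h' [r' [E' R']]] := divM m.
exists (x *: h' + h), (x *: r' + r); split; last first.
  by move=> m' am'; rewrite mcoeffD mcoeffZ R ?R' // mulr0 addr0.
by rewrite E E' mulrDl scalerDr scalerAl addrACA.
Qed.

(* The remainder of the division by the binomial has no two distinct monomials
   whose exponents differ by a multiple of d. *)
Lemma torus_ideal_binomial S H d (c : K) g :
  (exists2 v, S v & torus v) -> S `<=` @torus K N ->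
  (forall q v, H q -> S v -> S (pmul q v)) ->
  (forall a b, (forall q, H q -> 'X_[a].@[q] = 'X_[b].@[q]) ->
     exists k : int, expo a - expo b = k *: d) ->
  (forall v, S v -> chi d v = c) -> (exists i, 0 < d 0 i) ->
  (forall v, S v -> g.@[v] = 0) ->
  exists h, g = h * ('X_[pos_part d] - c *: 'X_[pos_part (- d)]).
Proof.
move=> S0 ST SH Hd Sc [i di] Sg.
(* At this i the exponent in d+ is d_i > 0 and the exponent in d- is 0. *)
have [|h [r [E R]]] := @binomial_division (pos_part d) (pos_part (- d)) c i g.
  by rewrite !mnmE !mxE; move: (d 0 i) di => z; case: ifP; case: ifP; lia.
exists h; rewrite E; suff -> : r = 0 by rewrite addr0.
apply/eqP/negP => /negP r0.
have Sr v : S v -> r.@[v] = 0.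
  move=> Sv; have := Sg v Sv; rewrite E mevalD mevalM mevalB mevalZ.
  by rewrite chi_pos_part ?(Sc v) ?subrr ?mulr0 ?add0r //; apply: ST.
(* Where d_j >= 0, a_j = b_j + k d_j >= d_j; elsewhere d+ is 0. The sign of k then decides which of
   X^a and X^b is excluded from the remainder. *)
have pos_le a b (k : int) : 0 < k -> expo a - expo b = k *: d ->
    (pos_part d <= a)%MM.
  move=> k0 /rowP Ek; apply/mnm_lepP => j; have := Ek j; rewrite !mxE mnmE.
  move: (d 0 j) => z; case: ifP => // z0; nia.
have [a [b [ar br ab Hab]]] := dedekind_pair S0 SH Sr r0.
have [k Ek] := Hd a b Hab.
have Ek' : expo b - expo a = (- k) *: d by rewrite scaleNr -Ek opprB.
move: ar br; rewrite !mcoeff_msupp; case: (ltgtP k 0) => k0.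
- by rewrite [r@_b]R ?eqxx // (pos_le b a (- k)) ?oppr_gt0.
- by rewrite [r@_a]R ?eqxx // (pos_le a b k).
move: Ek; rewrite k0 scale0r => /eqP; rewrite subr_eq0 => /eqP/rowP Ekj _ _.
by case/eqP: ab; apply/mnmP => j; have := Ekj j; rewrite !mxE => -[].
Qed.

End TorusHypersurface.

(** * From projective hypersurfaces to the torus points of their cones *)

Section ProjectiveHypersurface.
Variables (K : numClosedFieldType) (n : nat).
Implicit Types (v w q : 'I_n.+1 -> K) (V C : set (Pn K n)).
Implicit Types (f g h : {mpoly K[n.+1]}).

Lemma meval_homog_scale f d (s : K) v : f \is d.-homog ->
  f.@[fun i => s * v i] = s ^+ d * f.@[v].
Proof.
move=> /dhomogP fd; rewrite !mevalEX mulr_sumr; apply: eq_big_seq => m /fd md.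
rewrite mulrCA; congr (_ * _); rewrite !mevalX -md /= mdegE -prodrXr -big_split.
by apply: eq_bigr => i _; rewrite exprMn.
Qed.

Lemma zero_locus1P f d (a : nzvec K n) : f \is d.-homog ->
  zero_locus [set f] (pt a) <-> f.@[val a 0] = 0.
Proof.
move=> fd; split=> [/(_ f erefl a erefl)//|fa g -> b /ptP[s s0 Eab]].
move: fa; rewrite Eab => /eqP.
rewrite (@meval_eq _ _ _ (fun i => s * val b 0 i)); last by move=> i; rewrite mxE.
by rewrite (meval_homog_scale _ _ fd) mulf_eq0 expf_eq0 (negPf s0) andbF => /eqP.
Qed.

Lemma zariski_closed_zero_locus1 f d : f \is d.-homog ->
  zariski_closed (zero_locus [set f]).
Proof. by move=> fd; exists [set f] => // g ->; exists d. Qed.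

Lemma nzvec_of_torus v : torus v -> exists a : nzvec K n, forall i, val a 0 i = v i.
Proof.
move=> Tv; have a0 : \row_i v i != 0.
  by apply/eqP => /rowP/(_ ord0); rewrite !mxE; apply/eqP.
by exists (exist _ (\row_i v i) a0) => i; rewrite /= mxE.
Qed.

Lemma torus_point V : ~ (V `<=` coord_hyperplanes K n) ->
  exists2 a : nzvec K n, V (pt a) & torus (fun i => val a 0 i).
Proof.
move=> /existsNP[p /not_implyP[Vp Dp]]; exists (repr p).
  by rewrite /pt reprK.
move=> i; apply/negP => /eqP pi0; apply: Dp; exists i => //.
have -> : p = pt (repr p) by rewrite /pt reprK.
have X1 : ('X_i : {mpoly K[n.+1]}) \is 1.-homog by rewrite dhomogX /= mdeg1.
by apply/(zero_locus1P _ X1); rewrite mevalXU.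
Qed.

(** Partial products of torus points have nonzero coordinates, so each product in the recursion is
    defined, and a Hadamard product contains the set whose closure it is. *)
Lemma hadamard_pow_prod V (u : nat -> 'I_n.+1 -> K) :
  (forall k, torus (u k)) ->
  (forall k (a : nzvec K n), (forall i, val a 0 i = u k i) -> V (pt a)) ->
  forall r (a : nzvec K n), (forall i, val a 0 i = \prod_(k < r) u k i) ->
  hadamard_pow V r (pt a).
Proof.
move=> Tu Vu; elim=> [|r IH] a Ea /=.
  apply/ptP; exists 1; first exact: oner_neq0.
  by apply/rowP => i; rewrite Ea big_ord0 !mxE mulr1.
apply: sub_gen_smallest.
have [b Eb] := nzvec_of_torus (Tu r).
have [|c Ec] := @nzvec_of_torus (fun i => \prod_(k < r) u k i).
  by move=> i; rewrite prodf_seq_neq0; apply/allP=> k _; apply: Tu.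
exists (pt b), (pt c); split; [exact: (Vu r)|exact: IH|].
exists b, c, a; split=> //; apply/rowP => i.
by rewrite Ea !mxE Eb Ec big_ord_recr mulrC.
Qed.

Lemma torus_zeros_prod f d t (u : nat -> 'I_n.+1 -> K) : f \is d.-homog ->
  hadamard_pow (zero_locus [set f]) t = zero_locus [set f] ->
  (forall k, torus_zeros f (u k)) ->
  torus_zeros f (fun i => \prod_(k < t) u k i).
Proof.
move=> fd ft Zu.
have Tp : torus (fun i => \prod_(k < t) u k i).
  by move=> i; rewrite prodf_seq_neq0; apply/allP=> k _; case: (Zu k) => + _; apply.
split=> //; have [a Ea] := nzvec_of_torus Tp.
rewrite -(meval_eq _ Ea); apply/(zero_locus1P _ fd); rewrite -ft.
apply: (@hadamard_pow_prod _ u) => // [k|k b Eb]; first by case: (Zu k).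
by apply/(zero_locus1P _ fd); rewrite (meval_eq _ Eb); case: (Zu k).
Qed.

(* C lies in the union of the hypersurface g = 0 and of the coordinate
   hyperplanes. *)
Lemma irreducible_torus_vanishing C g d : irreducible_closed C ->
  ~ (C `<=` coord_hyperplanes K n) -> g \is d.-homog ->
  (forall a : nzvec K n, C (pt a) -> torus (fun i => val a 0 i) ->
    g.@[val a 0] = 0) ->
  ideal_of C g.
Proof.
move=> [_ _ irrC] CD gd Cg.
(* X^e is the product of all coordinates; its zero locus is the union of the coordinate
   hyperplanes. *)
pose e : 'X_{1..n.+1} := [multinom 1%N | i < n.+1].
have ed : ('X_[e] : {mpoly K[n.+1]}) \is (mdeg e).-homog by rewrite dhomogX.
have [|||CG|CE] := irrC (zero_locus [set g]) (zero_locus [set 'X_[e]]).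
- exact: zariski_closed_zero_locus1 gd.
- exact: zariski_closed_zero_locus1 ed.
- move=> p Cp; have Ep : p = pt (repr p) by rewrite /pt reprK.
  move: Cp; rewrite Ep => Cp.
  have [/asboolP Tp|/asboolPn/existsNP[i /negP]] :=
    boolP `[< torus (fun i => val (repr p) 0 i) >].
    by left; apply/(zero_locus1P _ gd)/Cg.
  rewrite negbK => /eqP pi0; right; apply/(zero_locus1P _ ed).
  by rewrite mevalX (bigD1 i) //= mnmE expr1 pi0 mul0r.
- by move=> p /CG; apply.
have [a Ca Ta] := torus_point CD.
have /(zero_locus1P _ ed)/eqP := CE _ Ca.
by rewrite (negPf (meval_monom_neq0 _ Ta)).
Qed.

Lemma torus_zeros_homog_scale f d (s : K) v : f \is d.-homog -> s != 0 ->
  torus_zeros f v -> torus_zeros f (pmul (fun=> s) v).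
Proof.
move=> fd s0 [Tv fv]; split; first exact: torus_pmul.
by rewrite (meval_homog_scale _ _ fd) fv mulr0.
Qed.

(** The cone is stable under doubling all coordinates, which multiplies [chi x] by 2 to the sum of
    the x_i. *)
Lemma chi_constant_homog f d x : f \is d.-homog -> torus_zeros f !=set0 ->
  chi_constant (torus_zeros f) x -> \sum_i x 0 i = 0.
Proof.
move=> fd [v Zv] cx; have two0 : 2 != 0 :> K by rewrite pnatr_eq0.
have /esym/eqP := cx v _ Zv (torus_zeros_homog_scale fd two0 Zv).
rewrite chiM chi_cst // -{2}[chi x v]mul1r (inj_eq (mulIf _)); last first.
  by apply: chi_neq0; case: Zv.
by rewrite pexprz_eq1 ?ler0n // (eqr_nat K 2 1) orbF => /eqP.
Qed.

(** This makes the binomial with exponents x+ and x- homogeneous. *)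
Lemma mdeg_pos_part (x : 'rV[int]_n.+1) : \sum_i x 0 i = 0 ->
  mdeg (pos_part x) = mdeg (pos_part (- x)).
Proof.
move=> x0; apply/eqP; rewrite -eqz_nat -subr_eq0 !mdegE.
rewrite !(big_morph Posz PoszD erefl) -x0 -sumrB; apply/eqP/eq_bigr => i _.
by have /rowP/(_ i) := expo_pos_part x; rewrite !mxE.
Qed.

Lemma exists_pos_coord (x : 'rV[int]_n.+1) : \sum_i x 0 i = 0 -> x != 0 ->
  exists i, 0 < x 0 i.
Proof.
move=> x0 xN0; apply: contrapT => /forallNP xle.
have x_le0 i : 0 <= - x 0 i by have /negP := xle i; rewrite -leNgt oppr_ge0.
move/eqP: xN0; apply; apply/rowP => i; rewrite mxE.
have /eqP : \sum_i (- x 0 i) = 0 by rewrite sumrN x0 oppr0.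
rewrite psumr_eq0 // => /allP/(_ i).
by rewrite mem_index_enum oppr_eq0 => /(_ isT)/eqP.
Qed.

(** For v, w in [S], both w v^t and v v^t multiply [S] into itself, so the character is 1 at both;
    cancelling v^t gives equal values at w and v. *)
Lemma chi_constant_of_multipliers (S : set ('I_n.+1 -> K)) t a b :
  S `<=` @torus K n.+1 ->
  (forall u : nat -> 'I_n.+1 -> K, (forall k, S (u k)) ->
     S (fun i => \prod_(k < t.+2) u k i)) ->
  (forall q, (forall v, S v -> S (pmul q v)) -> 'X_[a].@[q] = 'X_[b].@[q]) ->
  chi_constant S (expo a - expo b).
Proof.
move=> ST Sprod Hab v w Sv Sw.
pose q x y : 'I_n.+1 -> K := pmul x (fun i => y i ^+ t).
have Sq x y z : S x -> S y -> S z -> S (pmul (q x y) z).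
  move=> Sx Sy Sz.
  have -> : pmul (q x y) z =
      (* The default value [y] of [nth] supplies the t factors after z and x. *)
      fun i => \prod_(k < t.+2) nth y [:: z; x] k i.
    apply/funext => i; rewrite !big_ord_recl /= mulrC.
    rewrite (eq_bigr (fun=> y i)) => [|k _]; last by rewrite nth_nil.
    by rewrite prodr_const card_ord.
  by apply: Sprod => -[|[|k]] //=; rewrite nth_nil.
have Eq x y : S x -> S y -> chi (expo a - expo b) (q x y) = 1.
  move=> Sx Sy; have Tq : torus (q x y).
    by move=> i; rewrite mulf_neq0 ?expf_neq0 //; apply: ST.
  rewrite chiD // chiN !chi_expo (Hab _ (fun z => Sq x y z Sx Sy)).
  by rewrite mulfV // meval_monom_neq0.
have := Eq w v Sw Sv; rewrite -(Eq v v Sv Sv).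
rewrite !chiM => /esym/mulIf; apply.
by apply: chi_neq0 => i; rewrite expf_neq0 //; apply: ST.
Qed.

End ProjectiveHypersurface.

(** * Binomial equations of a hypersurface equal to one of its Hadamard powers *)

Section HadamardIdempotent.
Variables (K : numClosedFieldType) (n : nat) (C : set (Pn K n)) (t : nat).
Hypothesis hC : irreducible_hypersurface C.
Hypothesis hD : ~ (C `<=` coord_hyperplanes K n).

Lemma binomial_equation_of_hadamard_pow : hadamard_pow C t.+2 = C ->
  exists2 c : K, c ^+ t.+1 = 1 & binomial_equation C 1 c.
Proof.
move=> hCt; case: (hC) => -[d [f [d_gt0 f0 fd EC]]] irrC.
have [a0 Ca0 Ta0] := torus_point hD.
have inC (a : nzvec K n) : C (pt a) <-> f.@[val a 0] = 0.
  by rewrite EC; apply: zero_locus1P fd.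
pose v0 i := val a0 0 i; pose Z := torus_zeros f.
have Zv0 : Z v0 by split=> //; apply/inC.
have Z0 : Z !=set0 by exists v0.
have ZT : Z `<=` @torus K n.+1 by move=> v [].
have Zprod : forall u, (forall k : nat, Z (u k)) ->
    Z (fun i => \prod_(k < t.+2) u k i).
  by move=> u; apply: torus_zeros_prod fd _; rewrite -EC.
pose H := [set q : 'I_n.+1 -> K | forall v, Z v -> Z (pmul q v)].
have SH q v : H q -> Z v -> Z (pmul q v) by move=> Hq; apply: Hq.
have ZTv : exists2 v, Z v & torus v by exists v0.
have cstH := fun a b => @chi_constant_of_multipliers _ _ Z t a b ZT Zprod.
(* Applied to the equation [f] itself, independence yields a first nontrivial character constant on
   [Z]. *)
have [|a [b [_ _ ab Hab]]] := @dedekind_pair _ _ Z H f ZTv SH _ f0.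
  by move=> v [].
have [|m [m0 cm mgen]] := chi_constant_cyclic Z0 (cstH _ _ Hab).
  apply: contraNneq ab => /eqP; rewrite subr_eq0 => /eqP/rowP E.
  by apply/eqP/mnmP => i; have := E i; rewrite !mxE => -[].
have m_sum := chi_constant_homog fd Z0 cm.
pose c := chi m v0; pose I := pos_part m; pose J := pos_part (- m).
pose B : {mpoly K[n.+1]} := 1 *: 'X_[I] - c *: 'X_[J].
have Bd : B \is (mdeg I).-homog.
  by rewrite rpredB // rpredZ // dhomogX //= /I (mdeg_pos_part m_sum).
(* [B] vanishes at the torus points of [C]; irreducibility extends this to all of [C]. *)
have CB : ideal_of C B.
  apply: (irreducible_torus_vanishing irrC hD Bd) => x Cx Tx.
  rewrite mevalB !mevalZ mul1r chi_pos_part // (cm _ v0) ?subrr //.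
  by split=> //; apply/inC.
exists c.
  apply: (mulIf (chi_neq0 m Ta0)); rewrite mul1r -exprSr.
  have := cm _ _ (Zprod (fun=> v0) (fun=> Zv0)) Zv0.
  have -> : (fun i => \prod_(k < t.+2) v0 i) = fun i => v0 i ^+ t.+2.
    by apply/funext => i; rewrite prodr_const card_ord.
  move=> <-; rewrite /c /chi -prodrXl; apply: eq_bigr => i _.
  by rewrite exprnP exprzAC.
exists I, J; split.
- by apply/eqP => /pos_part_inj/eqP; apply/negP.
- exact: mdeg_pos_part.
move=> g; split=> [Cg|[h ->] p Cp x Ex]; last by rewrite mevalM (CB p) ?mulr0.
rewrite scale1r; apply: (@torus_ideal_binomial _ _ Z H) ZTv ZT SH _ _ _ _ => //.
- by move=> x y /cstH/mgen.
- by move=> v Zv; apply: cm.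
- exact: exists_pos_coord.
move=> v [Tv fv]; have [x Ex] := nzvec_of_torus Tv.
rewrite -(meval_eq _ Ex); apply: (Cg (pt x)) => //.
by apply/inC; rewrite (meval_eq _ Ex).
Qed.

(** For minimality an arbitrary binomial equation has to be treated. Comparing X^I = c X^J at a
    torus point v and at v^(t+2) gives c^(t+2) = c. *)
Lemma binomial_coef_hadamard_pow (c : K) : hadamard_pow C t.+2 = C ->
  c != 0 -> binomial_equation C 1 c -> c ^+ t.+1 = 1.
Proof.
move=> hCt c0 [I [J [_ _ defC]]]; case: (hC) => -[d [f [d_gt0 f0 fd EC]]] irrC.
have [a0 Ca0 Ta0] := torus_point hD.
pose v0 i := val a0 0 i.
have fv0 : torus_zeros f v0 by split=> //; apply/(zero_locus1P _ fd); rewrite -EC.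
have CB : ideal_of C (1 *: 'X_[I] - c *: 'X_[J]).
  by apply/defC; exists 1; rewrite mul1r.
have IJ v : torus_zeros f v -> 'X_[I].@[v] = c * 'X_[J].@[v].
  move=> [Tv fv]; have [x Ex] := nzvec_of_torus Tv.
  have Cx : C (pt x).
    by rewrite EC; apply/(zero_locus1P _ fd); rewrite (meval_eq _ Ex).
  have := CB _ Cx _ erefl; rewrite (meval_eq _ Ex) mevalB !mevalZ mul1r => /eqP.
  by rewrite subr_eq0 => /eqP.
have Zp : torus_zeros f (fun i => v0 i ^+ t.+2).
  have -> : (fun i => v0 i ^+ t.+2) = fun i => \prod_(k < t.+2) v0 i.
    by apply/funext => i; rewrite prodr_const card_ord.
  by apply: (torus_zeros_prod (u := fun=> v0) fd) => //; rewrite -EC.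
have XX (m : 'X_{1..n.+1}) : 'X_[m].@[fun i => v0 i ^+ t.+2] = 'X_[m].@[v0] ^+ t.+2.
  by rewrite !mevalX -prodrXl; apply: eq_bigr => i _; rewrite exprAC.
have := IJ _ Zp; rewrite !XX IJ // exprMn => /mulIf E.
apply: (mulIf c0); rewrite mul1r -exprSr E //.
by rewrite expf_neq0 // meval_monom_neq0.
Qed.

End HadamardIdempotent.

(** * Type and minimality of the exponent over the complex numbers *)

Theorem proposition5p4 (R : realType) (n : nat) (C : set (Pn R[i] n)) (t : nat)
    (hC : irreducible_hypersurface C)
    (hD : ~ (C `<=` coord_hyperplanes R[i] n))
    (ht : (2 <= t)%N)
    (hCt : hadamard_pow C t = C) :
  (exists2 e : nat, (1 <= e <= t - 1)%N & binomial_hypersurface_of_type C t e)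
  /\
  (forall e : nat, (1 <= e <= t - 1)%N -> binomial_hypersurface_of_type C t e ->
     coprime (t - 1) e ->
     forall s : nat, (2 <= s)%N -> hadamard_pow C s = C -> (t <= s)%N).
Proof.
case: t ht hCt => [|[|t]] // _ hCt; rewrite subSS subn0; split.
  have [c ct eqC] := binomial_equation_of_hadamard_pow hC hD hCt.
  have [xi xiP] := closed_prim_root_exists R[i] (ltn0Sn t).
  have [k Ek] := prim_rootP xiP ct.
  have c0 : c != 0.
    by apply/eqP => c0; move/eqP: ct; rewrite c0 expr0n eq_sym oner_eq0.
  (* The exponent 0 lies outside the allowed range and is replaced by the order of [xi], which gives
     the same power. *)
  pose e := if val k == 0%N then t.+1 else val k.
  have Ee : xi ^+ e = c.
    by rewrite Ek /e; case: eqP => // ->; rewrite (prim_expr_order xiP) expr0.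
  have e_bd : (1 <= e <= t.+1)%N.
    rewrite /e; case: eqP => [_|/eqP k0]; first by rewrite leqnn.
    by rewrite lt0n k0 (ltnW (ltn_ord k)).
  exists e => //; split; rewrite ?subSS ?subn0 //.
    by split=> //; exists 1, c; split=> //; apply: oner_neq0.
  by exists xi => //; rewrite Ee.
move=> e _ [_ _ _ [xi]]; rewrite subSS subn0 => xiP eqC co [|[|s]] // _ hCs.
have xi0 : xi ^+ e != 0 by rewrite expf_neq0 // (prim_root_eq0 xiP).
(* With [t.+1] the order of [xi] and [s.+1] one less than the competing exponent: [t.+1] divides e
   times [s.+1], hence [s.+1] by coprimality. *)
have := binomial_coef_hadamard_pow hC hD hCs xi0 eqC.
rewrite -exprM => /eqP; rewrite -(prim_order_dvd xiP) Gauss_dvdr //.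
by move=> /dvdn_leq; apply.
Qed.
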